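(* Let $S$ be a local ring (commutative with identity) with maximal ideal $\mathfrak m$ and residue field $S/\mathfrak m\cong\mathbb F_{p^\lambda}$, where $p$ is a prime and $\lambda\ge1$, and let $(N,+,\circ)$ be an $S$-brace of order a power of $p$. If $\mathrm{rank}_{\mathbb Z}N<\lambda(p-1)$, then $(N,+)$ and $(N,\circ)$ have the same number of elements of each order. In particular, if $(N,\circ)$ is abelian, then $(N,+)\cong(N,\circ)$ as groups.
   Context: A (left) brace is a set $N$ with two group operations $+$ and $\circ$, with $(N,+)$ abelian, such that $x\circ(y+z)=(x\circ y)-x+(x\circ z)$ for all $x,y,z\in N$. Its gamma function is $x\mapsto\gamma_x$, where $\gamma_x(y)=-x+x\circ y$; each $\gamma_x$ is an automorphism of $(N,+)$. Given a ring $R$, an $R$-brace is a brace $(N,+,\circ)$ such that $(N,+)$ is a (unital) $R$-module and every $\gamma_x$ ($x\in N$) is an automorphism of $R$-modules. For a finite abelian group $M$, $\mathrm{rank}_{\mathbb Z}M$ is the number of summands in the decomposition of $(M,+)$ as a direct sum of nonzero indecomposable cyclic groups. *)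

(* Defs.v *)
From HB Require Import structures.
From mathcomp Require Import all_boot all_order all_algebra.
From mathcomp Require Import all_fingroup all_solvable.
From mathcomp Require Import ring_quotient.

Set Implicit Arguments.
Unset Strict Implicit.
Unset Printing Implicit Defensive.

Import GRing.Theory.
Local Open Scope ring_scope.

Record brace (N : zmodType) := Brace {
  circ : N -> N -> N;
  circ_one : N;
  circ_inv : N -> N;
  circA : associative circ;
  circ1x : left_id circ_one circ;
  circVx : left_inverse circ_one circ_inv circ;
  circDr : forall x y z : N, circ x (y + z) = circ x y - x + circ x z
}.

Definition gamma (N : zmodType) (B : brace N) (x y : N) : N := - x + circ B x y.

Record module_brace (R : nzRingType) (N : lmodType R) := ModuleBrace {
  module_brace_brace :> brace N;
  gamma_linear : forall x : N, linear (gamma module_brace_brace x);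
  gamma_bij : forall x : N, bijective (gamma module_brace_brace x)
}.

(* N itself canonically carries the group law +; the alias circ_group B has the
   same elements but carries the group law circ B. *)
Definition circ_group (N : finZmodType) (B : brace N) : Type := N.

HB.instance Definition _ (N : finZmodType) (B : brace N) :=
  Finite.on (circ_group B).
HB.instance Definition _ (N : finZmodType) (B : brace N) :=
  Finite_isGroup.Build (circ_group B) (@circA N B) (@circ1x N B) (@circVx N B).

(* The type idealr only contains proper ideals. *)
Definition maximal_ideal (S : comNzRingType) (m : idealr S) : Prop :=
  forall J : idealr S, {subset m <= J} -> J =i m.

Definition local_ring_with (S : comNzRingType) (m : idealr S) : Prop :=
  maximal_ideal m /\ forall J : idealr S, maximal_ideal J -> J =i m.

Definition ring_isomorphic (A B : nzRingType) : Prop :=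
  exists f : {rmorphism A -> B}, bijective f.

Section RankZ.

Local Open Scope group_scope.
Variable gT : finGroupType.
Implicit Types (G H A B : {group gT}) (Hs : seq {group gT}).

Definition indecomposable G : Prop :=
  forall A B, A \x B = G -> A :=: 1 \/ B :=: 1.

(* The number of summands does not depend on the decomposition, so this relation
   is the graph of the rank: see has_rankZ_exists and has_rankZ_unique. *)
Definition has_rankZ G (r : nat) : Prop :=
  exists Hs, [/\ \big[dprod/1]_(H <- Hs) H = G,
                 forall H, H \in Hs -> [/\ cyclic H, H :!=: 1 & indecomposable H]
               & size Hs = r].

Lemma has_rankZ_exists G : abelian G -> exists r, has_rankZ G r.
Proof.
have [n] := ubnP #|G|; elim: n G => // n IHn G; rewrite ltnS => leGn abG.
have [G1|ntG] := eqVneq (G : {set gT}) 1.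
  by exists 0%N, [::]; split; rewrite ?big_nil.
have [/existsP[A /existsP[B /and3P[/eqP defG ntA ntB]]]|indG] :=
  boolP [exists A : {group gT}, [exists B : {group gT},
          [&& A \x B == G, A :!=: 1 & B :!=: 1]]].
  have [/mulG_sub[sAG sBG] oG] := (dprodW defG, dprod_card defG).
  have gtA : (1 < #|A|)%N by rewrite cardG_gt1.
  have gtB : (1 < #|B|)%N by rewrite cardG_gt1.
  have [|rA [HA [dA pA _]]] := IHn A _ (abelianS sAG abG).
    by apply: leq_trans leGn; rewrite -oG ltn_Pmulr.
  have [|rB [HB [dB pB _]]] := IHn B _ (abelianS sBG abG).
    by apply: leq_trans leGn; rewrite -oG ltn_Pmull.
  exists (size (HA ++ HB)), (HA ++ HB); split=> // [|H].
    by rewrite big_cat /= dA dB.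
  by rewrite mem_cat => /orP[/pA|/pB].
exists 1%N, [:: G]; split=> //; first by rewrite big_seq1.
have iG : indecomposable G.
  move=> A B dG; have [->|ntA] := eqVneq (A : {set gT}) 1; first by left.
  have [->|ntB] := eqVneq (B : {set gT}) 1; first by right.
  case/existsP: indG; exists A; apply/existsP; exists B.
  by rewrite dG eqxx ntA.
move=> H; rewrite inE => /eqP->; split=> //.
have [b defG tyb] := abelian_structure abG.
have : all [preim (fun x : gT => #[x]%g) of ltn 1%N] b.
  by rewrite -all_map tyb abelian_type_gt1.
case: b defG {tyb} => [|x b]; first by rewrite big_nil => G1; rewrite -G1 eqxx in ntG.
rewrite big_cons => defG /andP[x1 _].
have [[K L _ dL] _ _ _] := dprodP defG.
rewrite dL in defG.
have [/= X1|L1] := iG <[x]>%G L defG; first by rewrite /= orderE X1 cards1 in x1.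
by move: defG; rewrite L1 dprodg1 => <-; exact: cycle_cyclic.
Qed.

Lemma cyclic_indecomposable_p_rank G : cyclic G -> G :!=: 1 -> indecomposable G ->
  forall q, 'r_q(G) = (q == pdiv #|G|).
Proof.
move=> cG ntG iG q; set p := pdiv #|G|.
have p_pr : prime p by rewrite pdiv_prime // cardG_gt1.
have nilG := abelian_nil (cyclic_abelian cG).
have pG : p.-group G.
  have dG := nilpotent_pcoreC p nilG; case: (iG _ _ dG) => O1; last first.
    by move: dG; rewrite O1 dprodg1 => <-; exact: pcore_pgroup.
  move: dG; rewrite O1 dprod1g => dG.
  have : p^'.-group G by rewrite -dG pcore_pgroup.
  by rewrite /pgroup p'natE // pdiv_dvd.
have [->|neq] := eqVneq q p.
  apply/eqP; rewrite eqn_leq p_rank_gt0 -rank_pgroup //.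
  by rewrite -abelian_rank1_cyclic ?cyclic_abelian // cG pi_pdiv cardG_gt1.
apply/eqP; rewrite eqn0Ngt p_rank_gt0; apply/negP => qG.
by case/negP: neq; exact: (pnatPpi pG qG).
Qed.

Lemma has_rankZ_unique G r1 r2 : has_rankZ G r1 -> has_rankZ G r2 -> r1 = r2.
Proof.
suff rankE r : has_rankZ G r -> r = (\sum_(q < #|G|.+1) 'r_q(G))%N.
  by move=> /rankE-> /rankE->.
case=> Hs [dG PHs <-] {r}.
have [n eqn leGn] : exists2 n, n = #|G|.+1 & (#|G| < n)%N by exists #|G|.+1.
rewrite -eqn {eqn}.
elim: Hs G dG PHs leGn => [|H Hs IH] G dG PHs leGn.
  move: dG; rewrite big_nil => G1; rewrite big1 // => q _.
  by rewrite -G1 p_rank1.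
move: dG; rewrite big_cons => dG; have [[K L _ dL] _ _ _] := dprodP dG.
rewrite dL in dG; have /mulG_sub[sHG sLG] := dprodW dG.
have [cH ntH iH] := PHs H (mem_head _ _).
have ltGn (K1 : {group gT}) : K1 \subset G -> (#|K1| < n)%N.
  by move=> sK; apply: leq_ltn_trans leGn; exact: subset_leq_card sK.
have pn : (pdiv #|H| < n)%N.
  by apply: leq_ltn_trans (ltGn _ sHG); rewrite pdiv_leq.
rewrite /= (IH L) ?ltGn // => [|J JHs]; last by apply: PHs; rewrite inE JHs orbT.
under [RHS]eq_bigr do
  rewrite -(p_rank_dprod _ dG) (cyclic_indecomposable_p_rank cH ntH iH).
rewrite big_split /= -[X in X = _]add1n; congr (_ + _)%N.
rewrite (bigD1 (Ordinal pn)) //= eqxx big1 // => i.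
by rewrite -val_eqE /= => /negPf->.
Qed.

End RankZ.

(* Main.v *)
Require Import Defs.
From HB Require Import structures.
From mathcomp Require Import all_boot all_order all_algebra.
From mathcomp Require Import all_fingroup all_solvable.
From mathcomp Require Import ring_quotient.
From mathcomp Require Import boolp.

Set Implicit Arguments.
Unset Strict Implicit.
Unset Printing Implicit Defensive.

Import GRing.Theory.
Local Open Scope ring_scope.

(** The theorem holds because every x has the same order in (N, +) as in
    (N, circ).

    Put d = gamma_x - 1, an S-linear endomorphism of N.  Since
    x circ y = x + gamma_x y, the p-th power of x for circ is the sum of the
    (1 + d)^i x for i < p, which expands as p (1 + d c) x + d^(p-1) x.
    Suppose that d^(p-1) x = p d g(d) x for some polynomial g over S.  Then this
    power is u (p x) with u = 1 + d h(d), and u is invertible because d is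
    nilpotent.  By induction on i, the circ-power of x of exponent p^i is
    trivial if and only if p^i x = 0; as both orders are powers of p, they agree
    ([circ_expg_prime_power_eq0], [circ_order]).

    It remains to prove that d^(p-2) maps the submodule M = S[d] x into pM
    ([iter_gamma_sub1_div]).  If it did not, then, d being nilpotent, the
    submodules pM + d^j M for 0 <= j < p would decrease strictly, and each step
    would have index at least #|S / m| = p^lambda because a nonzero finite
    S-module has a composition factor S / m ([submod_index],
    [submod_nilpotent_index]).  So #|M| >= p^(lambda (p - 1)) #|pM|.  But
    #|M| <= #|pM| #|N[p]|, where N[p] is the kernel of multiplication by p, and
    #|N[p]| <= p^rank(N) < p^(lambda (p - 1)).

    Finally, two finite abelian groups in which each equation z^n = 1 has the
    same number of solutions are isomorphic ([isog_abelian_card_Ldiv]). *)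

(** * Binomial expansions modulo a prime *)

Section Binomial.
Variables (R : comNzRingType) (p : nat).
Hypothesis p_pr : prime p.

Lemma exprD_prime (a b : R) :
  exists c, (a + b) ^+ p = a ^+ p + b ^+ p + c *+ p.
Proof.
have [p' Dp] : exists p', p = p'.+1 by exists p.-1; rewrite prednK ?prime_gt0.
rewrite exprDn Dp big_ord_recl big_ord_recr /= -Dp subn0 bin0 /bump /= add1n -Dp.
rewrite subnn binn !mulr1n !expr0 mulr1 mul1r.
exists (\sum_(i < p') (a ^+ (p - i.+1) * b ^+ i.+1 *+ ('C(p, i.+1) %/ p)%N)).
rewrite -sumrMnl -addrA [X in _ + X]addrC; congr (_ + (_ + _)).
apply: eq_bigr => i _; rewrite -mulrnA divnK ?add1n //.
by apply: prime_dvd_bin => //=; rewrite Dp ltnS ltn_ord.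
Qed.

Lemma exprD1_prime_power (x : R) k :
  exists c, (1 + x) ^+ (p ^ k) = 1 + x ^+ (p ^ k) + c *+ p.
Proof.
elim: k => [|k [c IHk]]; first by exists 0; rewrite mul0rn addr0 !expr1.
have [d Dd] := exprD_prime (1 + x ^+ (p ^ k)) (c *+ p).
have [e De] := exprD_prime 1 (x ^+ (p ^ k)).
exists (e + (c ^+ p *+ p ^ p.-1 + d)); rewrite expnSr !exprM IHk Dd De expr1n.
have -> : (c *+ p) ^+ p = c ^+ p *+ p ^ p.-1 *+ p.
  by rewrite exprMn_n -mulrnA -expnSr prednK ?prime_gt0.
by rewrite -!addrA -!mulrnDl.
Qed.

(** This is ((1 + x)^n - 1) / x, stated so that it makes sense when x is not
    invertible. *)
Lemma sum_exprD1 (x : R) n :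
  \sum_(i < n) (1 + x) ^+ i = \sum_(i < n) x ^+ i *+ 'C(n, i.+1).
Proof.
elim: n => [|n IHn]; first by rewrite !big_ord0.
rewrite big_ord_recr /= {}IHn [1 + x]addrC exprD1n.
under [RHS]eq_bigr do rewrite binS mulrnDr.
by rewrite big_split /= [in RHS]big_ord_recr /= bin_small // mulr0n addr0.
Qed.

Lemma sum_exprD1_prime (x : R) :
  exists c, \sum_(i < p) (1 + x) ^+ i = (1 + x * c) *+ p + x ^+ p.-1.
Proof.
rewrite sum_exprD1.
have [p' Dp] : exists p', p = p'.+2.
  by exists p.-2; case: (p) p_pr => [|[|]].
exists (\sum_(i < p') x ^+ i *+ ('C(p, i.+2) %/ p)).
have recE (F : nat -> R) :
    \sum_(i < p) F i = F 0%N + \sum_(i < p') F i.+1 + F p.-1.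
  by rewrite Dp big_ord_recl big_ord_recr addrA.
rewrite (recE (fun i => x ^+ i *+ 'C(p, i.+1))) bin1 expr0 prednK ?prime_gt0 //.
rewrite binn mulr1n mulrnDl; congr (_ + _ + _).
rewrite mulr_sumr -sumrMnl; apply: eq_bigr => i _.
rewrite -mulrnAr -mulrnA divnK ?mulrnAr -?exprS //.
by apply: prime_dvd_bin => //=; rewrite Dp !ltnS ltn_ord.
Qed.
End Binomial.

(** * The action of polynomials in an endomorphism *)

Section PolyAct.
Variables (S : comNzRingType) (V : lmodType S) (f : {linear V -> V}).
Implicit Types (g h : {poly S}) (x y : V).

Definition poly_act g y := \sum_(i < size g) g`_i *: iter i f y.

Lemma poly_act_widen n g y : (size g <= n)%N ->
  poly_act g y = \sum_(i < n) g`_i *: iter i f y.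
Proof.
move=> le_g_n; rewrite /poly_act.
rewrite (big_ord_widen n (fun i => g`_i *: iter i f y)) //.
rewrite big_mkcond /=; apply: eq_bigr => i _.
by case: ltnP => // ?; rewrite nth_default ?scale0r.
Qed.

Lemma poly_act_linearl y : linear (poly_act^~ y).
Proof.
move=> c g h.
have [le_g le_h] :=
  (leq_maxl (size g) (size h), leq_maxr (size g) (size h)).
rewrite !(@poly_act_widen (maxn (size g) (size h))) //; last first.
  rewrite (leq_trans (size_polyD _ _)) //.
  by rewrite geq_max le_h (leq_trans (size_scale_leq _ _)).
rewrite scaler_sumr -big_split; apply: eq_bigr => i _ /=.
by rewrite coefD coefZ scalerDl scalerA.
Qed.

Lemma poly_act_linearr g : linear (poly_act g).
Proof.
move=> c x y; rewrite /poly_act scaler_sumr -big_split; apply: eq_bigr => i _ /=.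
have -> : iter i f (c *: x + y) = c *: iter i f x + iter i f y.
  by elim: (nat_of_ord i) => //= j ->; rewrite linearP.
by rewrite scalerDr !scalerA [g`_i * c]mulrC.
Qed.

HB.instance Definition _ g :=
  GRing.isLinear.Build S V V *:%R (poly_act g) (poly_act_linearr g).

Lemma poly_actDl g h y : poly_act (g + h) y = poly_act g y + poly_act h y.
Proof. by rewrite -[g in LHS]scale1r poly_act_linearl scale1r. Qed.

Lemma poly_act0l y : poly_act 0 y = 0.
Proof. by rewrite /poly_act size_poly0 big_ord0. Qed.

Lemma poly_actZl c g y : poly_act (c *: g) y = c *: poly_act g y.
Proof. by rewrite -[_ *: g]addr0 poly_act_linearl poly_act0l addr0. Qed.

Lemma poly_actNl g y : poly_act (- g) y = - poly_act g y.
Proof. by rewrite -[in LHS]scaleN1r poly_actZl scaleN1r. Qed.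

Lemma poly_actMnl g y n : poly_act (g *+ n) y = poly_act g y *+ n.
Proof. by rewrite -[in LHS]scaler_nat poly_actZl scaler_nat. Qed.

Lemma poly_actC c y : poly_act c%:P y = c *: y.
Proof.
rewrite (@poly_act_widen 1) ?size_polyC_leq1 //.
by rewrite big_ord_recl big_ord0 addr0 coefC eqxx.
Qed.

Lemma poly_act1 y : poly_act 1 y = y.
Proof. by rewrite -polyC1 poly_actC scale1r. Qed.

Lemma poly_actXM g y : poly_act ('X * g) y = f (poly_act g y).
Proof.
rewrite (@poly_act_widen (size g).+1); last first.
  by rewrite (leq_trans (size_polyMleq _ _)) // size_polyX.
rewrite big_ord_recl coefXM eqxx scale0r add0r linear_sum /=.
by apply: eq_bigr => i _; rewrite coefXM linearZ.
Qed.

Lemma poly_actM g h y : poly_act (g * h) y = poly_act g (poly_act h y).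
Proof.
elim/poly_ind: g h y => [|g c IHg] h y; first by rewrite mul0r !poly_act0l.
rewrite mulrDl -mulrA !poly_actDl !IHg mul_polyC poly_actC.
rewrite poly_actZl poly_actXM; congr (poly_act g _ + _).
by rewrite -[in RHS](mulr1 'X) poly_actXM poly_act1.
Qed.

Lemma poly_actX y : poly_act 'X y = f y.
Proof. by rewrite -(mulr1 'X) poly_actXM poly_act1. Qed.

Lemma poly_act_exp g n y : poly_act (g ^+ n) y = iter n (poly_act g) y.
Proof.
by elim: n => [|n IHn]; rewrite ?expr0 ?poly_act1 // exprS poly_actM IHn.
Qed.

Lemma poly_actXn n y : poly_act 'X^n y = iter n f y.
Proof. by rewrite poly_act_exp; apply: eq_iter => z; rewrite poly_actX. Qed.

(** Modulo p, (1 + 'X)^(p^k) is 1 + 'X^(p^k); hence f^(p^k) is divisible by p,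
    and its e-th power vanishes. *)
Lemma unipotent_sub1_nilpotent p e k : prime p ->
    (forall y, y *+ p ^ e = 0) ->
    (forall y, iter (p ^ k) (fun z => z + f z) y = y) ->
  exists n, forall y, iter n f y = 0.
Proof.
move=> p_pr p_tors unip.
have [c Dc] := exprD1_prime_power p_pr ('X : {poly S}) k.
have fq y : iter (p ^ k) f y = poly_act (- c) y *+ p.
  have: poly_act ((1 + 'X) ^+ (p ^ k)) y = y.
    rewrite poly_act_exp -[RHS]unip; apply: eq_iter => z.
    by rewrite poly_actDl poly_act1 poly_actX.
  rewrite Dc !poly_actDl poly_act1 poly_actXn poly_actMnl poly_actNl -addrA.
  by move/(canRL (addKr _))/eqP; rewrite addNr addr_eq0 mulNrn => /eqP.
exists (p ^ k * e)%N => y; rewrite -[RHS](p_tors (poly_act ((- c) ^+ e) y)).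
rewrite -poly_actXn exprM poly_act_exp.
transitivity (iter e (fun z => poly_act (- c) z *+ p) y).
  by apply: eq_iter => z; rewrite poly_actXn fq.
elim: e {p_tors} => [|e IHe] /=; first by rewrite expr0 poly_act1.
by rewrite {}IHe exprS poly_actM raddfMn -mulrnA expnSr.
Qed.

(** An identity plus a nilpotent map is injective: y = - f (g y) can be iterated
    until f^n appears. *)
Lemma poly_act_1DX_inj n g : (forall y, iter n f y = 0) ->
  forall y, poly_act (1 + 'X * g) y = 0 -> y = 0.
Proof.
move=> nilf y /eqP; rewrite poly_actDl poly_act1 addr_eq0 => /eqP Dy.
have {}Dy : y = poly_act (- ('X * g)) y by rewrite poly_actNl.
have: y = poly_act ((- ('X * g)) ^+ n) y.
  by elim: n {nilf} => [|n IHn]; rewrite ?poly_act1 // exprSr poly_actM -Dy.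
by rewrite exprNn exprMn mulrCA poly_actM poly_actXn nilf.
Qed.
End PolyAct.

(** * Indices of submodules over a local ring *)

Lemma residue_section (S : comNzRingType) (m : idealr S) (F : nzRingType) :
  ring_isomorphic {ideal_quot m} F ->
  exists lift : F -> S, forall c d, lift c - lift d \in m -> c = d.
Proof.
case=> f [g fK gK]; exists (fun c => generic_quotient.repr (g c)) => c d.
by rewrite Quotient.idealrBE !reprK => /eqP/(can_inj gK).
Qed.

Section Length.
Variables (S : comNzRingType) (m : idealr S) (N : finLmodType S).
Variables (T : finType) (lift : T -> S).
(* [T] and [lift] stand for a set of elements of S that are pairwise incongruent
   modulo m, such as representatives of the residue field. *)
Hypothesis loc_m : local_ring_with m.
Hypothesis lift_inj : forall c d, lift c - lift d \in m -> c = d.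
Implicit Types (A P : {set N}).

Section ColonIdeal.
Variables (P : {set N}) (a : N).
Hypotheses (subP : submod_closed P) (Pa : a \notin P).

Definition colon_ideal : {pred S} := [pred s | s *: a \in P].

Lemma colon_idealr_closed : idealr_closed colon_ideal.
Proof.
have [P0 PD] := subP; split; first by rewrite inE scale0r.
  by rewrite inE scale1r.
by move=> s u v; rewrite !inE => Pu Pv; rewrite scalerDl -scalerA PD.
Qed.

HB.instance Definition _ := isIdealr.Build S colon_ideal colon_idealr_closed.

Definition colon_idealr : idealr S := colon_ideal.

End ColonIdeal.

(** Replace A by a submodule B that is minimal over P.  For a in B but not in P,
    minimality gives B = S s a + P whenever s a is not in P, so the ideal of the
    s with s a in P is maximal, hence equal to m.  Multiples of a by
    representatives modulo m are then pairwise incongruent modulo P. *)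
Lemma submod_index A P : submod_closed A -> submod_closed P ->
  P \proper A -> (#|T| * #|P| <= #|A|)%N.
Proof.
move=> subA subP ltPA.
have [P0 PD] := subP.
pose Q := [pred B : {set N} | `[< submod_closed B >] && (P \proper B)].
have [|B /minsetP[/andP[/asboolP subB ltPB] minB] sBA] := @minset_exists _ Q A.
  by rewrite inE ltPA andbT; apply/asboolP.
apply: leq_trans (subset_leq_card sBA) => {A subA ltPA sBA}.
have [sPB [a Ba Pa]] := properP ltPB; have [_ BD] := subB.
have maxI : colon_idealr subP Pa =i m.
  apply: (proj2 loc_m) => J sIJ s; apply/idP/idP; last exact: sIJ.
  move=> Js; apply/negPn/negP; rewrite inE => Psa.
  (* By minimality C = S s a + P is B; writing a = t s a + z with z in P then
     puts 1 - t s, hence 1, in J. *)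
  pose C := [set y | `[< exists t, exists2 z, z \in P & y = t *: (s *: a) + z >]].
  have Csa : s *: a \in C.
    by rewrite inE; apply/asboolP; exists 1, 0; rewrite ?scale1r ?addr0.
  have sCB : C \subset B.
    apply/subsetP=> y; rewrite inE => /asboolP[t [z Pz ->]].
    have BsaZ : s *: a \in B.
      by rewrite -[_ *: _]addr0; apply: BD Ba (subsetP sPB _ P0).
    exact: BD BsaZ (subsetP sPB _ Pz).
  have subC : submod_closed C.
    split.
      by rewrite inE; apply/asboolP; exists 0, 0; rewrite ?scale0r ?addr0.
    move=> c u v; rewrite !inE => /asboolP[t [z Pz ->]].
    move=> /asboolP[t' [z' Pz' ->]].
    apply/asboolP; exists (c * t + t'), (c *: z + z'); first exact: PD.
    by rewrite scalerDr addrACA scalerDl -!scalerA.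
  have ltPC : P \proper C.
    apply/properP; split; last by exists (s *: a).
    apply/subsetP=> z Pz; rewrite inE; apply/asboolP; exists 0, z => //.
    by rewrite scale0r add0r.
  have CB : C = B by apply: minB => //=; rewrite ltPC andbT; apply/asboolP.
  have Ca : a \in C by rewrite CB.
  move: Ca; rewrite inE => /asboolP[t [z Pz /eqP]].
  rewrite -subr_eq0 opprD addrA scalerA -[X in X - _ - _]scale1r.
  rewrite -scalerBl subr_eq0 => /eqP Dz.
  have J1 : 1 - t * s \in J by apply: sIJ; rewrite inE Dz.
  by have := rpredD J1 (idealMr t Js); rewrite subrK idealr1.
rewrite -cardsT -cardsX.
pose h (u : T * N) := lift u.1 *: a + u.2.
rewrite -(@card_in_imset _ _ h) => [|[c y] [d z]]; last first.
  rewrite /h !inE /= => Py Pz Dy.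
  have Dyz : lift c *: a - lift d *: a = - 1 *: y + z.
    by apply/eqP; rewrite scaleN1r subr_eq addrC addrCA -Dy addrC addrK.
  have Dc : c = d by apply: lift_inj; rewrite -maxI inE scalerBl Dyz PD.
  by move: Dy; rewrite Dc => /addrI->.
apply: subset_leq_card; apply/subsetP=> y /imsetP[[c z]].
rewrite !inE /= => Pz ->.
exact: BD Ba (subsetP sPB _ Pz).
Qed.

(** One step replaces A by A' = P + f A.  If A' were equal to A, iterating would
    give A = P + f^k A = P by nilpotency, against the last hypothesis; so
    [submod_index] applies to A' inside A. *)
Lemma submod_nilpotent_index (f : {linear N -> N}) k n A P :
    submod_closed A -> submod_closed P -> P \subset A ->
    {in A, forall y, f y \in A} -> {in P, forall y, f y \in P} ->
    (forall y, iter k f y = 0) ->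
    (exists2 y, y \in A & iter n f y \notin P) ->
  (#|T| ^ n.+1 * #|P| <= #|A|)%N.
Proof.
move=> + subP + + stabP nilf; have [P0 PD] := subP.
elim: n A => [|n IHn] A subA sPA stabA [y Ay Pfy].
  by rewrite expn1 submod_index //; apply/properP; split=> //; exists y.
pose A' := [set z + f a | z in P, a in A].
have [A0 AD] := subA.
have subA' : submod_closed A'.
  split; first by apply/imset2P; exists 0 0; rewrite ?linear0 ?addr0.
  move=> c _ _ /imset2P[z a Pz Aa ->] /imset2P[z' a' Pz' Aa' ->].
  apply/imset2P; exists (c *: z + z') (c *: a + a'); rewrite ?PD ?AD //.
  by rewrite linearP scalerDr addrACA.
have fA' a : a \in A -> f a \in A'.
  by move=> Aa; apply/imset2P; exists 0 a; rewrite ?add0r.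
have sA'A : A' \subset A.
  apply/subsetP=> _ /imset2P[z a Pz Aa ->].
  by rewrite -(scale1r z); apply: AD (subsetP sPA _ Pz) (stabA _ Aa).
have sPA' : P \subset A'.
  by apply/subsetP=> z Pz; apply/imset2P; exists z 0; rewrite ?linear0 ?addr0.
have IH : (#|T| ^ n.+1 * #|P| <= #|A'|)%N.
  apply: IHn => // [z A'z|]; first by rewrite fA' ?(subsetP sA'A).
  by exists (f y); rewrite ?fA' -?iterSr.
rewrite expnS -mulnA (leq_trans (leq_mul (leqnn _) IH)) //.
apply: submod_index => //; rewrite properEneq sA'A andbT.
apply: contraNneq Pfy => EA.
have decA j a : a \in A ->
    exists2 z, z \in P & exists2 b, b \in A & a = z + iter j f b.
  move=> Aa; elim: j => [|j [z Pz [b Ab ->]]].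
    by exists 0 => //; exists a; rewrite ?add0r.
  move: Ab; rewrite -{1}EA => /imset2P[z' b' Pz' Ab' ->].
  exists (1 *: z + iter j f z').
    by rewrite PD //; elim: (j) => //= i; apply: stabP.
  exists b' => //; rewrite scale1r -addrA; congr (_ + _).
  by rewrite iterSr; elim: (j) => //= i ->; rewrite linearD.
have [z Pz [b _ ->]] := decA k y Ay.
by rewrite nilf addr0; elim: (n.+1) => //= i; apply: stabP.
Qed.
End Length.

Lemma leq_card_kernel_image (U : finZmodType) (f : {additive U -> U})
    (A : {set U}) :
  (#|A| <= #|f @: A| * #|[set y | f y == 0%R]|)%N.
Proof.
have [s sK] : exists s : U -> U, forall x, x \in A -> f (s (f x)) = f x.
  exists (fun z => odflt 0 [pick x | f x == z]) => x Ax.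
  by case: pickP => [y /eqP //|/(_ x)]; rewrite eqxx.
rewrite -cardsX -(@card_in_imset _ _ (fun x => (f x, x - s (f x))%R)).
  apply: subset_leq_card; apply/subsetP=> _ /imsetP[x Ax ->].
  by rewrite !inE /= imset_f //= raddfB sK ?subrr.
by move=> x y _ _ [-> /addIr].
Qed.

(** * Rank of a finite abelian p-group *)

Section Rank.
Local Open Scope group_scope.
Implicit Types (gT : finGroupType) (p : nat).

Lemma has_rankZ_p_rank gT (G : {group gT}) p r :
  prime p -> p.-group G -> has_rankZ G r -> 'r_p(G) = r.
Proof.
move=> p_pr pG [Hs [dG PHs <-]] {r}.
elim: Hs G pG dG PHs => [|H Hs IH] G pG dG PHs.
  by move: dG; rewrite big_nil => G1; rewrite -G1 p_rank1.
move: dG; rewrite big_cons => dG; have [[K L _ dL] _ _ _] := dprodP dG.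
rewrite dL in dG; have /mulG_sub[sHG sLG] := dprodW dG.
have [cH ntH iH] := PHs H (mem_head _ _).
rewrite -(p_rank_dprod _ dG) (cyclic_indecomposable_p_rank cH ntH iH).
rewrite (IH L (pgroupS sLG pG) dL) => [|J JHs]; last first.
  by apply: PHs; rewrite inE JHs orbT.
have /eqnP->: pdiv #|H| \in (p : nat_pred).
  by rewrite (pnatPpi (pgroupS sHG pG)) // pi_pdiv cardG_gt1.
by rewrite eqxx.
Qed.
End Rank.

(** * Order statistics determine a finite abelian group *)

Section OrderStatistics.
Local Open Scope group_scope.
Implicit Types gT rT : finGroupType.

Lemma card_Ldiv_dprod gT (A B G : {group gT}) n :
  abelian G -> A \x B = G -> (#|'Ldiv_n(G)| = #|'Ldiv_n(A)| * #|'Ldiv_n(B)|)%N.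
Proof.
move=> cGG defG; have [_ defAB _ tiAB] := dprodP defG.
have [sAG sBG] := mulG_sub defAB.
have cAA := abelianS sAG cGG; have cBB := abelianS sBG cGG.
pose LA := Group (group_Ldiv n cAA); pose LB := Group (group_Ldiv n cBB).
have tiL : LA :&: LB = 1.
  by apply/trivgP; rewrite -tiAB; apply: setISS; exact: subsetIl.
rewrite -[RHS](TI_cardMg tiL).
apply: eq_card => z; apply/idP/mulsgP => [|[a b]].
  case/LdivP; rewrite -defAB => /mulsgP[a b Aa Bb ->] => /eqP.
  have cab : commute a b.
    by apply: (centsP cGG); [apply: (subsetP sAG) | apply: (subsetP sBG)].
  rewrite expgMn // -eq_invg_mul => /eqP Dab.
  have a1 : a ^+ n = 1.
    by apply/set1gP; rewrite -tiAB inE groupX //= -groupV Dab groupX //.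
  exists a b => //=; first by apply/LdivP.
  by apply/LdivP; rewrite -Dab a1 invg1.
move=> /LdivP[Aa a1] /LdivP[Bb b1] ->; apply/LdivP.
have [Ga Gb] := (subsetP sAG a Aa, subsetP sBG b Bb).
by rewrite groupM // expgMn ?a1 ?b1 ?mulg1 //; apply: (centsP cGG).
Qed.

Lemma isog_card_Ldiv gT rT (G : {group gT}) (H : {group rT}) n :
  G \isog H -> #|'Ldiv_n(G)| = #|'Ldiv_n(H)|.
Proof.
case/isogP=> f injf <-; rewrite -injm_Ldiv //.
by rewrite card_injm // subsetIl.
Qed.

(** Equal counts force equal cardinals and equal exponents.  Cyclic subgroups
    generated by elements of order the exponent split off on both sides, and
    the counts of solutions in the complements agree again because these counts
    are multiplicative in direct products. *)
Lemma isog_abelian_card_Ldiv gT rT (G : {group gT}) (H : {group rT}) :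
    abelian G -> abelian H -> (forall n, #|'Ldiv_n(G)| = #|'Ldiv_n(H)|) ->
  G \isog H.
Proof.
have [k] := ubnP #|G|; elim: k G H => // k IHk G H /ltnSE-leGk cGG cHH eqL.
have LdivT aT (K : {group aT}) n : (exponent K %| n)%N -> #|'Ldiv_n(K)| = #|K|.
  by rewrite -sub_LdivT => /setIidPl->.
have oGH : #|G| = #|H|.
  rewrite -(LdivT _ G (#|G| * #|H|)%N) ?dvdn_mulr ?exponent_dvdn //.
  by rewrite eqL LdivT // dvdn_mull ?exponent_dvdn.
have exp_dvd n : (exponent G %| n)%N = (exponent H %| n)%N.
  rewrite -!sub_LdivT !(sameP setIidPl eqP) !eqEcard !subsetIl /=.
  by rewrite eqL oGH.
have eqe : exponent G = exponent H.
  by apply/eqP; rewrite eqn_dvd exp_dvd dvdnn -exp_dvd dvdnn.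
have [G1 | ntG] := eqVneq (G : {set gT}) 1.
  have H1 : H :=: 1 by apply: card1_trivg; rewrite -oGH G1 cards1.
  by rewrite G1 H1 isog_cyclic_card ?cyclic1 // !cards1.
have [x Gx ex] := exponent_witness (abelian_nil cGG).
have [y Hy ey] := exponent_witness (abelian_nil cHH).
have /splitsP[K /complP[tiK defG]] := abelian_splits Gx (esym ex) cGG.
have /splitsP[L /complP[tiL defH]] := abelian_splits Hy (esym ey) cHH.
have [sxG sKG] := mulG_sub defG; have [syH sLH] := mulG_sub defH.
have dG : <[x]> \x K = G by rewrite dprodE // (sub_abelian_cent2 cGG).
have dH : <[y]> \x L = H by rewrite dprodE // (sub_abelian_cent2 cHH).
have isoxy : <[x]> \isog <[y]>.
  by rewrite isog_cyclic_card ?cycle_cyclic //= -!orderE -ex -ey eqe.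
apply: (isog_dprod dG dH isoxy); apply: IHk;
  rewrite ?(abelianS sKG) ?(abelianS sLH) //.
  apply: leq_trans leGk; rewrite -(dprod_card dG) ltn_Pmull ?cardG_gt0 //.
  rewrite -orderE -ex ltn_neqAle exponent_gt0.
  by rewrite andbT eq_sym -dvdn1 -trivg_exponent ntG.
move=> n; have := eqL n; rewrite (card_Ldiv_dprod n cGG dG).
rewrite (card_Ldiv_dprod n cHH dH).
rewrite (isog_card_Ldiv n isoxy) => /eqP; rewrite eqn_pmul2l => [/eqP //|].
by apply/card_gt0P; exists 1; apply/LdivP; rewrite group1 expg1n.
Qed.
End OrderStatistics.

(** * Powers in the circle group *)

Section BraceTheory.
Variables (S : comNzRingType) (N : finLmodType S) (B : module_brace N).
Implicit Types x y z : N.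

HB.instance Definition _ x :=
  GRing.isLinear.Build S N N *:%R (gamma B x) (gamma_linear B x).

Definition gamma_sub1 x : {linear N -> N} := gamma B x \- idfun.

Lemma circE x y : circ B x y = x + gamma B x y.
Proof. by rewrite /gamma addNKr. Qed.

Lemma circ_one0 : circ_one B = 0.
Proof. by rewrite -(circ1x B 0) circE linear0 addr0. Qed.

Lemma circ_group_one0 : (1%g : circ_group B) = (0 : N).
Proof. exact: circ_one0. Qed.

Lemma gamma_circ x y z : gamma B (circ B x y) z = gamma B x (gamma B y z).
Proof.
have := circA B x y z; rewrite !circE linearD addrA.
by move=> /addrI.
Qed.

Lemma gamma_expg x n :
  gamma B ((x : circ_group B) ^+ n)%g =1 iter n (gamma B x).
Proof.
elim: n => [|n IHn] y /=; last by rewrite expgS gamma_circ IHn.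
by rewrite expg0 circ_group_one0 /gamma -{2}circ_one0 circ1x oppr0 add0r.
Qed.

Lemma iter_gammaE x n y :
  iter n (gamma B x) y = poly_act (gamma_sub1 x) ((1 + 'X) ^+ n) y.
Proof.
rewrite poly_act_exp; apply: eq_iter => z.
by rewrite poly_actDl poly_act1 poly_actX /= addrC subrK.
Qed.

Lemma circ_expgE x n :
  ((x : circ_group B) ^+ n)%g =
    poly_act (gamma_sub1 x) (\sum_(i < n) (1 + 'X) ^+ i) x :> N.
Proof.
elim: n => [|n IHn]; first by rewrite big_ord0 poly_act0l expg0 circ_group_one0.
rewrite expgSr [LHS]circE gamma_expg IHn iter_gammaE.
by rewrite big_ord_recr poly_actDl.
Qed.

Variables (m : idealr S) (T : finType) (lift : T -> S) (p lambda k : nat).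
Hypothesis loc_m : local_ring_with m.
Hypothesis lift_inj : forall c d, lift c - lift d \in m -> c = d.
Hypothesis p_pr : prime p.
Hypothesis cardN : #|N| = (p ^ k)%N.
Hypothesis cardT : #|T| = (p ^ lambda)%N.
(* In terms of the rank r of (N, +), the left-hand side is p ^ r. *)
Hypothesis oK : (#|[set y : N | y *+ p == 0%R]| < p ^ (lambda * p.-1))%N.

(** The circle group has p-power order, and so does gamma_x. *)
Lemma gamma_sub1_nilpotent x : exists n, forall y, iter n (gamma_sub1 x) y = 0.
Proof.
apply: (@unipotent_sub1_nilpotent _ _ _ p k k p_pr) => y.
  by rewrite -cardN -FinRing.zmodXgE -cardsT expg_cardG ?inE.
transitivity (iter (p ^ k) (gamma B x) y).
  by apply: eq_iter => z /=; rewrite addrC subrK.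
rewrite -gamma_expg -cardN -[#|N|](cardsT (circ_group B)) expg_cardG ?inE //.
exact: (gamma_expg x 0).
Qed.

(** The bound on the p-torsion enters here: if d^(p-2) did not map S[d] x into
    p S[d] x, where d = gamma_x - 1, there would be p - 1 strict steps between
    these submodules, too many for their index.  Staying inside S[d] x rather
    than N makes d^(p-2) x equal to p g(d) x for a polynomial g. *)
Lemma iter_gamma_sub1_div x :
  exists g, iter p.-1 (gamma_sub1 x) x =
    poly_act (gamma_sub1 x) ('X * g) x *+ p.
Proof.
pose f := gamma_sub1 x; have [n nilf] := gamma_sub1_nilpotent x.
pose M := [set y | `[< exists g, y = poly_act f g x >]].
have subM : submod_closed M.
  split; first by rewrite inE; apply/asboolP; exists 0; rewrite poly_act0l.
  move=> c u v; rewrite !inE => /asboolP[g ->] /asboolP[h ->].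
  by apply/asboolP; exists (c *: g + h); rewrite poly_act_linearl.
have stabM : {in M, forall y, f y \in M}.
  move=> y; rewrite !inE => /asboolP[g ->].
  by apply/asboolP; exists ('X * g); rewrite poly_actXM.
pose h : {additive N -> N} := poly_act f p%:R.
have hE y : h y = y *+ p by rewrite /h /= poly_actMnl poly_act1.
have [M0 MD] := subM.
have subP : submod_closed (h @: M).
  split; first by apply/imsetP; exists 0; rewrite ?hE ?mul0rn.
  move=> c _ _ /imsetP[u Mu ->] /imsetP[v Mv ->].
  by apply/imsetP; exists (c *: u + v); rewrite ?MD // !hE mulrnDl scalerMnr.
have sPM : h @: M \subset M.
  apply/subsetP=> _ /imsetP[y + ->]; rewrite !inE => /asboolP[g ->].
  by apply/asboolP; exists (p%:R * g); rewrite poly_actM.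
have stabP : {in h @: M, forall y, f y \in h @: M}.
  move=> _ /imsetP[u Mu ->]; apply/imsetP; exists (f u); rewrite ?stabM //.
  by rewrite !hE raddfMn.
have Mx : x \in M by rewrite inE; apply/asboolP; exists 1; rewrite poly_act1.
have Dp : p.-1 = p.-2.+1 by case: (p) p_pr => [|[|]].
have: iter p.-2 f x \in h @: M.
  apply/negPn/negP => Pfx.
  have := submod_nilpotent_index loc_m lift_inj subM subP sPM stabM stabP nilf
    (ex_intro2 _ _ x Mx Pfx).
  rewrite -Dp cardT -expnM leqNgt => /negP[].
  apply: leq_ltn_trans (leq_card_kernel_image h M) _.
  rewrite mulnC ltn_pmul2r; last by apply/card_gt0P; exists (h x); apply: imset_f.
  by under eq_finset do rewrite hE.
case/imsetP=> y; rewrite inE => /asboolP[g ->] Dfx; exists g.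
by rewrite Dp iterS Dfx hE raddfMn poly_actXM.
Qed.

Lemma circ_expg_primeE x : exists g,
  ((x : circ_group B) ^+ p)%g = poly_act (gamma_sub1 x) (1 + 'X * g) (x *+ p) :> N.
Proof.
have [g Dg] := iter_gamma_sub1_div x.
have [c Dc] := sum_exprD1_prime p_pr ('X : {poly S}).
exists (c + g); rewrite circ_expgE Dc poly_actDl poly_actMnl poly_actXn Dg.
by rewrite -mulrnDl -poly_actDl -addrA -mulrDr raddfMn.
Qed.

(** The factor 1 + d h(d) relating the circ-power of exponent p to p x is
    injective, so it preserves the additive order and the induction applies to
    the circ-power in place of x. *)
Lemma circ_expg_prime_power_eq0 x i :
  (((x : circ_group B) ^+ (p ^ i))%g == 1%g) = (x *+ (p ^ i) == 0).
Proof.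
elim: i x => [|i IHi] x; first by rewrite expn0 expg1 circ_group_one0.
rewrite expnS expgM IHi mulrnA.
have [g ->] := circ_expg_primeE x; rewrite -raddfMn.
apply/eqP/eqP => [|->]; last exact: raddf0.
have [n nilf] := gamma_sub1_nilpotent x.
exact: poly_act_1DX_inj nilf _.
Qed.

Lemma circ_order x : #[x : circ_group B]%g = #[x]%g.
Proof.
have dvd_exp (gT : finGroupType) (y : gT) :
    #|gT| = (p ^ k)%N -> exists i, #[y]%g = (p ^ i)%N.
  move=> ogT; have: (#[y]%g %| p ^ k)%N by rewrite -ogT -cardsT order_dvdG ?inE.
  by case/(dvdn_pfactor _ _ p_pr) => i _ ->; exists i.
have eq_dvd i : (#[x : circ_group B]%g %| p ^ i)%N = (#[x]%g %| p ^ i)%N.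
  by rewrite !order_dvdn circ_expg_prime_power_eq0.
have [i oi] := dvd_exp _ (x : circ_group B) cardN.
have [j oj] := dvd_exp N x cardN.
apply/eqP; rewrite eqn_dvd; apply/andP; split.
  by rewrite oj eq_dvd -oj.
by rewrite oi -eq_dvd -oi.
Qed.
End BraceTheory.

Theorem corollary4p9
    (S : comNzRingType) (m : idealr S)
    (p lambda : nat) (F : finFieldType)
    (N : finLmodType S) (B : module_brace N) (r : nat) :
  local_ring_with m ->
  prime p -> (0 < lambda)%N ->
  #|F| = (p ^ lambda)%N ->
  ring_isomorphic {ideal_quot m} F ->
  (exists k : nat, #|N| = (p ^ k)%N) ->
  has_rankZ [set: N]%G r ->
  (r < lambda * (p - 1))%N ->
  (forall n : nat,
     #|[set x : N | #[x]%g == n]| = #|[set x : circ_group B | #[x]%g == n]|)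
  /\ (abelian [set: circ_group B] ->
      [set: N]%G \isog [set: circ_group B]%G).
Proof.
move=> loc_m p_pr _ oF isoF [k oN] rankN lt_r.
have [lift lift_inj] := residue_section isoF.
pose K := [set y : N | y *+ p == 0].
have gK : group_set K.
  apply/group_setP; split=> [|y z]; first by rewrite inE mul0rn.
  by rewrite !inE mulrnDl => /eqP-> /eqP->; rewrite addr0.
have oK : (#|K| < p ^ (lambda * p.-1))%N.
  have pN : (p.-group [set: N])%g by rewrite /pgroup cardsT oN pnatX pnat_id.
  have abelK : (p.-abelem (Group gK))%g.
    apply/abelemP=> //; split; first exact: FinRing.zmod_abelian.
    by move=> y; rewrite inE => /eqP.
  rewrite -[#|K|]/#|Group gK| (card_pgroup (abelem_pgroup abelK)).
  rewrite -(p_rank_abelem abelK).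
  rewrite ltn_exp2l ?prime_gt1 // -subn1 (leq_ltn_trans _ lt_r) //.
  by rewrite -(has_rankZ_p_rank p_pr pN rankN) p_rankS ?subsetT.
have eq_order (x : N) : #[x : circ_group B]%g = #[x]%g.
  exact: circ_order loc_m lift_inj p_pr oN oF oK x.
split=> [n | cBB]; first by apply: eq_card => x; rewrite !inE eq_order.
apply: isog_abelian_card_Ldiv => // [|n]; first exact: FinRing.zmod_abelian.
by apply: eq_card => x; rewrite !inE -!order_dvdn eq_order.
Qed.
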